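(* Let $X,Y$ be complex Banach spaces with fixed weak topologies, and let $T\in B_\omega(X)$, $S\in B_\omega(Y)$, $\Psi\in B_\omega(X,Y)$ satisfy $\Psi T=S\Psi$. If the triple $(T,S,\Psi)$ has an approximate inverse intertwining, then every eigenvalue of $S$ belongs to $\sigma_{B_\omega(X)}(T)$.
   Context: A Banach space $X$ is supplied with a weak topology $\omega$ if a weak-$*$ dense closed subspace $M$ of the dual $X^*$ is chosen and $\omega=\sigma(X,M)$. $B_\omega(X)$ denotes the algebra of all $\omega$-continuous operators $T\in B(X)$ (equivalently $T^*M\subset M$), and $B_\omega(X,Y)$ denotes the space of operators in $B(X,Y)$ that are continuous with respect to the chosen weak topologies of $X$ and $Y$ (similarly $B_\omega(Y,X)$). $\sigma_{B_\omega(X)}(T)$ is the spectrum of $T$ in the algebra $B_\omega(X)$, i.e. the set of $\lambda\in\mathbb{C}$ for which $T-\lambda 1$ has no inverse in $B_\omega(X)$. An approximate inverse intertwining for $(T,S,\Psi)$ is a sequence $F_n\in B_\omega(Y,X)$ such that $F_n\Psi\to 1_X$, $\Psi F_n\to 1_Y$ and $TF_n-F_nS\to 0$ in the point-weak topologies, i.e. $F_n\Psi x\to x$ for all $x\in X$, $\Psi F_n y\to y$ for all $y\in Y$ and $(TF_n-F_nS)y\to 0$ for all $y\in Y$, the convergence being in the chosen weak topology of $X$, $Y$ and $X$ respectively. *)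

(* Defs.v *)
From HB Require Import structures.
From mathcomp Require Import all_boot all_order all_algebra.
From mathcomp Require Import complex.
From mathcomp Require Import boolp classical_sets functions reals.
From mathcomp Require Import topology normedtype.

Set Implicit Arguments.
Unset Strict Implicit.
Unset Printing Implicit Defensive.

Import Order.TTheory GRing.Theory Num.Theory.
Import numFieldNormedType.Exports.

Local Open Scope classical_set_scope.
Local Open Scope complex_scope.
Local Open Scope ring_scope.

Section Operators.
Context {R : realType}.
Implicit Types X Y : normedModType R[i].

Definition bounded_operator X Y (T : X -> Y) : Prop :=
  bounded_near T (nbhs (0 : X)).

(* X^*.  Functionals are plain functions X -> R[i]^o, so that the weak-*
   topology is the one induced by the pointwise topology {ptws X -> R[i]^o}. *)
Definition dual X : set (X -> R[i]^o) :=
  [set f | linear f /\ bounded_operator f].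

(* The norm of X is R[i]-valued (with nonnegative real values); the operator
   norm is taken in R, as a least Lipschitz constant. *)
Definition dual_norm X (f : X -> R[i]^o) : R :=
  inf [set c : R | 0 <= c /\ forall x, `|f x| <= c%:C * `|x|].

Definition norm_closed_in_dual X (M : set (X -> R[i]^o)) : Prop :=
  forall f, dual f ->
    (forall e : R, 0 < e -> exists2 g, M g & dual_norm (f - g) < e) -> M f.

Definition weak_star_dense X (M : set (X -> R[i]^o)) : Prop :=
  @dual X `<=` closure (M : set {ptws X -> R[i]^o}).

(* Choosing such an M is what supplies X with a weak topology. *)
Definition weak_datum X (M : set (X -> R[i]^o)) : Prop :=
  [/\ M `<=` @dual X,
      M 0 /\ (forall (a : R[i]) f g, M f -> M g -> M (a *: f + g)),
      norm_closed_in_dual M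
    & weak_star_dense M].

(* sigma M is the space X with the topology \sigma(X, M), the coarsest one
   that makes every functional of M continuous. *)
Definition sigma X (M : set (X -> R[i]^o)) : Type := X.

HB.instance Definition _ X (M : set (X -> R[i]^o)) :=
  Topological.copy (sigma M)
    (sup_topology (fun f : set_type M =>
       Topological.class (initial_topology (\val f : X -> R[i]^o)))).

Definition sigma_cvg X (M : set (X -> R[i]^o)) (u : nat -> sigma M)
    (x : sigma M) : Prop :=
  u @ \oo --> x.
#[global] Arguments sigma_cvg {X} M u x.

Definition sigma_continuous X Y (M : set (X -> R[i]^o))
    (N : set (Y -> R[i]^o)) (T : sigma M -> sigma N) : Prop :=
  continuous T.
#[global] Arguments sigma_continuous {X Y} M N T.

Definition B_omega X Y (M : set (X -> R[i]^o)) (N : set (Y -> R[i]^o))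
    (T : {linear X -> Y}) : Prop :=
  bounded_operator T /\ sigma_continuous M N T.

Definition invertible_in_B_omega X (M : set (X -> R[i]^o))
    (A : {linear X -> X}) : Prop :=
  exists2 U : {linear X -> X}, B_omega M M U & cancel A U /\ cancel U A.

Definition spectrum_B_omega X (M : set (X -> R[i]^o)) (T : {linear X -> X}) :
    set R[i] :=
  [set lam | ~ invertible_in_B_omega M (T \- lam \*: idfun)].

Definition is_eigenvalue Y (S : {linear Y -> Y}) (lam : R[i]) : Prop :=
  exists2 y : Y, y != 0 & S y = lam *: y.

Definition approximate_inverse_intertwining X Y
    (M : set (X -> R[i]^o)) (N : set (Y -> R[i]^o))
    (T : {linear X -> X}) (S : {linear Y -> Y}) (Psi : {linear X -> Y})
    (F : nat -> {linear Y -> X}) : Prop :=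
  [/\ forall n, B_omega N M (F n),
      forall x : X, sigma_cvg M (fun n => F n (Psi x)) x,
      forall y : Y, sigma_cvg N (fun n => Psi (F n y)) y
    & forall y : Y, sigma_cvg M (fun n => T (F n y) - F n (S y)) 0].

End Operators.

(* Main.v *)
Require Import Defs.
From HB Require Import structures.
From mathcomp Require Import all_boot all_order all_algebra.
From mathcomp Require Import complex.
From mathcomp Require Import boolp classical_sets functions reals.
From mathcomp Require Import topology normedtype.

Set Implicit Arguments.
Unset Strict Implicit.
Unset Printing Implicit Defensive.

Import Order.TTheory GRing.Theory Num.Theory.
Import numFieldNormedType.Exports.

Local Open Scope classical_set_scope.
Local Open Scope complex_scope.
Local Open Scope ring_scope.

(** Let [S y = lam *: y] with [y != 0], and suppose that [T - lam] has an
    inverse [U] in [B_omega(X)]. By linearity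
    [(T - lam) (F n y) = T (F n y) - F n (S y)], and the right-hand side tends
    weakly to [0] by the asymptotic intertwining relation. Weak continuity of
    [U] gives [F n y --> 0], and weak continuity of [Psi] then gives
    [Psi (F n y) --> 0]. But [Psi (F n y) --> y] as well, so [y = 0] as soon as
    weak limits in [Y] are unique: a contradiction.

    Uniqueness of weak limits ([sigma_cvg_unique]) carries all the analysis.
    It requires the chosen space of functionals to separate the points of [Y].
    By weak-star density that reduces to the whole dual separating points
    ([weak_star_dense_separates]), which is the Hahn-Banach theorem for a
    complex normed space ([dual_separates_points]).

    Hahn-Banach is proved with everywhere defined functionals, so that no
    extension from subspaces is needed: a minimal element among the sublinear
    functionals below the norm is linear ([linear_minimal_sublinear]), and it
    keeps a prescribed value at [x0] when the norm is first made linear along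
    [x0] ([hahn_banach_support]). The real functional obtained in this way is
    turned into a complex one by [complexify]. *)

(** * Sublinear functionals and the Hahn-Banach theorem *)

Section HahnBanach.
Context {R : realType} {V : lmodType R}.
Implicit Types (p q : V -> R) (x y : V) (t : R).

Definition subadditive q : Prop := forall x y, q (x + y) <= q x + q y.

Definition sublinear q : Prop :=
  subadditive q /\ forall t x, 0 <= t -> q (t *: x) = t * q x.

(** One inequality suffices for homogeneity, because it can be applied to the
    inverse scalar; the values [t = 2] and [t = 1 / 2] force [q 0 = 0]. *)
Lemma sublinear_le q : subadditive q ->
  (forall t x, 0 < t -> q (t *: x) <= t * q x) -> sublinear q.
Proof.
move=> qD qZ; split=> // t x; rewrite le_eqVlt => /predU1P[<-|t0]; last first.
  apply/le_anti/andP; split; first exact: qZ.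
  have tV0 : 0 < t^-1 by rewrite invr_gt0.
  by rewrite -ler_pdivlMl// -{1}(scale1r x) -(mulVf (lt0r_neq0 t0)) -scalerA qZ.
have := qZ 2 0; have := qZ 2^-1 0.
rewrite !scaler0 scale0r mul0r invr_gt0 ltr0n => /(_ isT) h1 /(_ isT) h2.
apply/le_anti/andP; split; last by rewrite mulr2n mulrDl mul1r lerDl in h2.
by move: h1; rewrite -ler_pdivrMl ?invr_gt0 ?ltr0n// invrK mulr2n mulrDl mul1r
  gerDl.
Qed.

Lemma sublinear0 q : sublinear q -> q 0 = 0.
Proof. by move=> [_ qZ]; rewrite -(scale0r 0) qZ// mul0r. Qed.

Lemma sublinear_ge_opp q x : sublinear q -> - q (- x) <= q x.
Proof.
move=> qs; rewrite -subr_ge0 opprK -(sublinear0 qs) -{1}(subrr x).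
by case: qs.
Qed.

Lemma inf_leD (A B C : set R) : A !=set0 -> B !=set0 -> has_lbound C ->
  (forall a b, A a -> B b -> exists2 c, C c & c <= a + b) ->
  inf C <= inf A + inf B.
Proof.
move=> A0 B0 lC AB; rewrite -lerBlDl; apply: lb_le_inf => // b Bb.
rewrite lerBlDl -lerBlDr; apply: lb_le_inf => // a Aa.
have [c Cc cab] := AB _ _ Aa Bb.
by rewrite lerBlDr (le_trans _ cab)//; exact: ge_inf.
Qed.

(** The largest sublinear functional below [q] whose value at [- y] is at most
    [- q y]: it lowers [q] just enough to be linear along [y]. *)
Definition flatten_along q y x : R :=
  inf [set q (x + t *: y) - t * q y | t in [set t | 0 <= t]].

Section FlattenAlong.
Variables (q : V -> R) (y : V).
Hypothesis qs : sublinear q.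

Let values x := [set q (x + t *: y) - t * q y | t in [set t | 0 <= t]].

Let values_neq0 x : values x !=set0.
Proof. by exists (q (x + 0 *: y) - 0 * q y); exists 0 => //=. Qed.

Let values_lb x : has_lbound (values x).
Proof.
exists (- q (- x)) => _ [t /= t0 <-]; have [qD qZ] := qs.
rewrite lerBrDl -lerBrDr opprK -qZ//.
by rewrite (le_trans _ (qD _ _))// addrAC subrr add0r.
Qed.

Let flatten_le_value t x : 0 <= t ->
  flatten_along q y x <= q (x + t *: y) - t * q y.
Proof. by move=> t0; apply: (ge_inf (values_lb x)); exists t. Qed.

Lemma flatten_along_le x : flatten_along q y x <= q x.
Proof.
by have := flatten_le_value x (lexx 0); rewrite scale0r addr0 mul0r subr0.
Qed.

Lemma flatten_along_opp : flatten_along q y (- y) <= - q y.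
Proof.
have := flatten_le_value (- y) ler01.
by rewrite scale1r addNr mul1r sublinear0// sub0r.
Qed.

Lemma sublinear_flatten_along : sublinear (flatten_along q y).
Proof.
have [qD qZ] := qs; apply: sublinear_le => [x x'|t x t0].
  apply: (inf_leD (values_neq0 _) (values_neq0 _) (values_lb _)).
  move=> _ _ [s /= s0 <-] [s' /= s'0 <-].
  exists (q (x + x' + (s + s') *: y) - (s + s') * q y).
    by exists (s + s') => //=; exact: addr_ge0.
  by rewrite scalerDl addrACA mulrDl opprD [leRHS]addrACA lerD2r.
rewrite -ler_pdivrMl//; apply: (lb_le_inf (values_neq0 _)) => _ [s /= s0 <-].
rewrite ler_pdivrMl//.
have := @flatten_le_value (t * s) (t *: x).
rewrite -scalerA -scalerDr qZ ?(ltW t0)// -mulrA -mulrBr; apply.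
exact: mulr_ge0 (ltW t0) s0.
Qed.

End FlattenAlong.

(** Zorn's lemma applies because the pointwise infimum of a chain of sublinear
    functionals is sublinear: it is finite since [- p (- x)] bounds every member
    below at [x], and of two members the smaller one serves both arguments in
    the subadditivity estimate. *)
Lemma minimal_sublinear p : sublinear p ->
  exists q, [/\ sublinear q, forall x, q x <= p x &
    forall r, sublinear r -> (forall x, r x <= q x) -> r = q].
Proof.
move=> ps; pose T := {q | sublinear q /\ forall x, q x <= p x}.
pose member q qs qp : T := exist _ q (conj qs qp).
pose geT (s t : T) := `[< forall x, sval t x <= sval s x >].
have [|||A totA|[q [qs qp]] qmin] := @Zorn T geT.
- by move=> s; apply/asboolP.
- move=> r s t /asboolP rs /asboolP st; apply/asboolP => x.
  exact: le_trans (st x) (rs x).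
- move=> [s hs] [t ht] /asboolP /= st /asboolP /= ts; apply: eq_exist.
  by apply/funext => x; apply/le_anti; rewrite st ts.
- have [[a Aa]|A0] := pselect (A !=set0); last first.
    exists (member p ps (fun=> lexx _)) => s As.
    by exfalso; apply: A0; exists s.
  pose vals x := [set sval s x | s in A].
  have vals0 x : vals x !=set0 by exists (sval a x); exists a.
  have lvals x : has_lbound (vals x).
    exists (- p (- x)) => _ [[s [ss sp]] As <-] /=.
    by rewrite (le_trans _ (sublinear_ge_opp x ss))// lerN2.
  have le_vals s x : A s -> inf (vals x) <= sval s x.
    by move=> As; apply: (ge_inf (lvals x)); exists s.
  have infs : sublinear (fun x => inf (vals x)).
    apply: sublinear_le => [x y|t x t0].
      apply: (inf_leD (vals0 _) (vals0 _) (lvals _)) => _ _ [s As <-] [s' As' <-].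
      have [/asboolP ss'|/asboolP s's] := totA _ _ As As'.
        exists (sval s' (x + y)); first by exists s'.
        by rewrite (le_trans ((svalP s').1.1 x y))// lerD2r.
      exists (sval s (x + y)); first by exists s.
      by rewrite (le_trans ((svalP s).1.1 x y))// lerD2l.
    rewrite -ler_pdivrMl//; apply: (lb_le_inf (vals0 _)) => _ [s As <-].
    by rewrite ler_pdivrMl// -(svalP s).1.2 ?(ltW t0)//; exact: le_vals.
  have infp x : inf (vals x) <= p x := le_trans (le_vals _ x Aa) ((svalP a).2 x).
  exists (member _ infs infp) => s As.
  by apply/asboolP => x /=; exact: le_vals.
exists q; split=> // r rs rq.
have rp x : r x <= p x := le_trans (rq x) (qp x).
have := qmin (member r rs rp).
have gerq : geT (member q qs qp) (member r rs rp).
  by apply/asboolP => x /=.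
by move=> /(_ gerq) [].
Qed.

(** A minimal sublinear functional coincides with all its flattenings, hence it
    is odd, and an odd subadditive functional is additive. *)
Lemma linear_minimal_sublinear q : sublinear q ->
  (forall r, sublinear r -> (forall x, r x <= q x) -> r = q) ->
  linear (q : V -> R^o).
Proof.
move=> qs qmin; have [qD qZ] := qs.
have qN x : q (- x) = - q x.
  apply/le_anti; rewrite -{1}(qmin _ (sublinear_flatten_along x qs)
    (flatten_along_le x qs)) flatten_along_opp//=.
  by rewrite lerNl sublinear_ge_opp.
have qDE x y : q (x + y) = q x + q y.
  apply/le_anti; rewrite qD/= -[leLHS]opprK -lerN2 opprK.
  rewrite opprD -!qN opprD; exact: qD.
have qZE t x : q (t *: x) = t * q x.
  have [t0|t0] := leP 0 t; first exact: qZ.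
  by rewrite -[t]opprK scaleNr qN qZ ?mulNr// oppr_ge0 ltW.
by move=> t x y; rewrite qDE qZE.
Qed.

(** A linear [f] below the flattening of [p] along [x0] satisfies
    [f (- x0) <= - p x0], that is [p x0 <= f x0]. *)
Theorem hahn_banach_support p x0 : sublinear p ->
  exists f : V -> R^o, [/\ linear f, forall x, f x <= p x & f x0 = p x0].
Proof.
move=> ps.
have [f [fs fp fmin]] := minimal_sublinear (sublinear_flatten_along x0 ps).
have lef x : f x <= p x := le_trans (fp x) (flatten_along_le x0 ps x).
exists f; split=> //; first exact: linear_minimal_sublinear.
apply/le_anti; rewrite lef/= -lerN2.
apply: le_trans (flatten_along_opp x0 ps); apply: le_trans (fp _).
by rewrite lerNl sublinear_ge_opp.
Qed.

End HahnBanach.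

(** * Separation of points in a complex normed space *)

Section RestrictionOfScalars.
Context {R : realType} (X : lmodType R[i]).

(** A separate type constant is required because [X] already carries its
    [R[i]]-module structure. *)
Definition restrict_scalars : Type := X.

HB.instance Definition _ := GRing.Zmodule.on restrict_scalars.

Let scale (t : R) (x : restrict_scalars) : restrict_scalars := t%:C *: (x : X).

Let scaleA a b v : scale a (scale b v) = scale (a * b) v.
Proof. by rewrite /scale scalerA rmorphM. Qed.

Let scale1 : left_id 1 scale.
Proof. by move=> v; rewrite /scale scale1r. Qed.

Let scaleDr : right_distributive scale +%R.
Proof. by move=> a u v; rewrite /scale scalerDr. Qed.

Let scaleDl v : {morph scale^~ v : a b / a + b}.
Proof. by move=> a b; rewrite /scale rmorphD scalerDl. Qed.

HB.instance Definition _ :=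
  GRing.Zmodule_isLmodule.Build R restrict_scalars scaleA scale1 scaleDr scaleDl.

(** The only complex-linear functional with real part [f], when [f] is
    real-linear: the imaginary part at [x] has to be minus the real part at
    ['i%C *: x]. *)
Definition complexify (f : restrict_scalars -> R^o) (x : X) : R[i]^o :=
  f x -i* f ('i%C *: x).

Lemma linear_complexify (f : restrict_scalars -> R^o) :
  linear f -> linear (complexify f).
Proof.
move=> fl.
have fD x y : f (x + y) = f x + f y by have := fl 1 x y; rewrite !scale1r.
have f0 : f 0 = 0 by apply: (@addrI _ (f 0)); rewrite -fD !addr0.
have fC (a : R[i]) (x : X) :
    f (a *: x) = complex.Re a * f x + complex.Im a * f ('i%C *: x).
  have fR (t : R) (z : X) : f (t%:C *: z) = t * f z.
    by have := fl t z 0; rewrite f0 !addr0.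
  by rewrite {1}(complexE a) scalerDl ['i%C * _]mulrC -scalerA fD !fR.
move=> a x y.
rewrite /complexify scalerDr scalerA !fD (fC a x) (fC ('i%C * a) x).
move: (f x) (f ('i%C *: x)) (f y) (f ('i%C *: y)) => u v u' v'.
case: a => a b; apply/eqP; rewrite eq_complex /=; apply/andP; split; apply/eqP.
  by rewrite mulrN opprK.
rewrite !mul0r !mul1r sub0r add0r !opprD mulNr opprK mulrN.
by rewrite [b * u - _]addrC.
Qed.

End RestrictionOfScalars.

Section DualSeparation.
Context {R : realType}.
Implicit Types X Y : normedModType R[i].

Definition real_norm X (x : restrict_scalars X) : R :=
  complex.Re `|x : X|.

Lemma real_normE X (x : X) : (real_norm x)%:C = `|x|.
Proof. by rewrite RRe_real ?normr_real. Qed.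

Lemma sublinear_real_norm X : sublinear (@real_norm X).
Proof.
split=> [x y|t x t0].
  by rewrite -lecR rmorphD /= !real_normE; exact: ler_normD.
apply: complexI; rewrite rmorphM /= real_normE.
by rewrite [LHS](normrZ t%:C (x : X)) ger0_norm ?ler0c// -real_normE.
Qed.

Lemma bounded_operator_lipschitz X Y (T : X -> Y) (c : R[i]) : 0 <= c ->
  (forall x, `|T x| <= c * `|x|) -> bounded_operator T.
Proof.
move=> c0 Tc; apply/ex_bound; exists c; apply/nbhs_norm0P; exists 1 => //= x /=.
by move=> /ltW x1; rewrite (le_trans (Tc x))// ler_piMr.
Qed.

(** A one-sided bound on [f] is two-sided because [f] is odd. The real and
    imaginary parts are bounded separately, which gives the constant [2]: not
    optimal, but any constant proves continuity. *)
Lemma bounded_complexify X (f : restrict_scalars X -> R^o) :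
  linear f -> (forall x, f x <= real_norm x) ->
  bounded_operator (complexify f : X -> R[i]^o).
Proof.
move=> fl fp.
have fN x : f (- x) = - f x.
  have fD u v : f (u + v) = f u + f v by have := fl 1 u v; rewrite !scale1r.
  apply: (@addrI _ (f x)); rewrite -fD !subrr.
  by apply: (@addrI _ (f 0)); rewrite -fD !addr0.
have absf (x : X) : `|(f x)%:C : R[i]| <= `|x|.
  rewrite normc_def /= expr0n addr0 sqrtr_sqr -real_normE lecR ler_norml fp.
  rewrite andbT lerNl -fN (le_trans (fp _))// -lecR !real_normE.
  by rewrite [leLHS](normrN (x : X)).
apply: (@bounded_operator_lipschitz _ _ _ 2) => // x.
have -> : complexify f x = (f x)%:C - 'i%C * (f ('i%C *: x))%:C :> R[i].
  by apply/eqP; rewrite eq_complex /= !mul0r !mul1r !subr0 !add0r !eqxx.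
rewrite mulr2n mulrDl mul1r (le_trans (ler_normB _ _))// lerD//.
have norm_i : `|'i%C : R[i]| = 1.
  by rewrite normc_def /= expr0n expr1n add0r sqrtr1.
rewrite normrM norm_i mul1r (le_trans (absf _))//.
by rewrite normrZ norm_i mul1r.
Qed.

(** If [f] supports the norm at [x], then [complexify f] is in the dual and its
    value at [x] has real part [`|x|]. *)
Lemma dual_separates_points X (x : X) : (forall f, dual f -> f x = 0) -> x = 0.
Proof.
move=> dual0.
have [f [fl fp fx]] :=
  hahn_banach_support (x : restrict_scalars X) (sublinear_real_norm X).
have := dual0 _ (conj (linear_complexify fl) (bounded_complexify fl fp)).
move=> /(congr1 (@complex.Re R)) /=; rewrite fx => nx0.
by apply/eqP; rewrite -normr_eq0 -real_normE nx0.
Qed.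

End DualSeparation.

(** * The weak topology defined by a space of functionals *)

Section WeakTopology.
Context {R : realType}.
Implicit Types X Y : normedModType R[i].

(** If [f x != 0], the functionals that do not vanish at [x] form a pointwise
    neighbourhood of [f], which weak-star density makes meet [M]. *)
Lemma weak_star_dense_separates X (M : set (X -> R[i]^o)) (x : X) :
  weak_star_dense M -> (forall g, M g -> g x = 0) -> x = 0.
Proof.
move=> Md Mx0; apply: dual_separates_points => f df; apply/eqP/negPn/negP => fx0.
have evx : continuous (fun h : {ptws X -> R[i]^o} => h x).
  exact: (@proj_continuous X (fun=> R[i]^o) x).
have nbf : nbhs (f : {ptws X -> R[i]^o}) [set h | h x != 0].
  exact: (cvgr_neq0 (f x) (evx f) fx0).
have [g [Mg /=]] := Md f df _ nbf.
by rewrite Mx0// eqxx.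
Qed.

Lemma sigma_cvg_functional X (M : set (X -> R[i]^o)) (u : nat -> X) (x : X) g :
  M g -> sigma_cvg M u x -> g (u n) @[n --> \oo] --> g x.
Proof.
move=> Mg /cvg_sup ux.
have {}ux := ux (exist _ g (mem_set Mg)).
exact: cvg_comp _ _ ux (@initial_continuous X _ g x).
Qed.

(** Each functional of [M] takes the same value at both limits, since limits
    of scalar sequences are unique. *)
Lemma sigma_cvg_unique X (M : set (X -> R[i]^o)) (u : nat -> X) (x y : X) :
  weak_datum M -> sigma_cvg M u x -> sigma_cvg M u y -> x = y.
Proof.
move=> [Mdual _ _ Md] ux uy; apply/eqP; rewrite -subr_eq0; apply/eqP.
apply: (weak_star_dense_separates Md) => g Mg.
have [gl _] := Mdual _ Mg.
have gxy : g x = g y.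
  exact: cvg_unique (sigma_cvg_functional Mg ux) (sigma_cvg_functional Mg uy).
by rewrite -(scaleN1r y) addrC gl gxy scaleN1r addNr.
Qed.

Lemma sigma_continuous_cvg X Y (M : set (X -> R[i]^o)) (N : set (Y -> R[i]^o))
    (T : X -> Y) (u : nat -> X) (x : X) :
  sigma_continuous M N T -> sigma_cvg M u x -> sigma_cvg N (T \o u) (T x).
Proof. by move=> Tc ux; exact: (cvg_comp _ _ ux (Tc x)). Qed.

End WeakTopology.

(** * Eigenvalues and approximate inverse intertwinings *)

Theorem theorem3p2 (R : realType) (X Y : completeNormedModType R[i])
    (M : set (X -> R[i]^o)) (N : set (Y -> R[i]^o))
    (hM : weak_datum M) (hN : weak_datum N)
    (T : {linear X -> X}) (S : {linear Y -> Y}) (Psi : {linear X -> Y})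
    (hT : B_omega M M T) (hS : B_omega N N S) (hPsi : B_omega M N Psi)
    (hTS : Psi \o T =1 S \o Psi)
    (hF : exists F : nat -> {linear Y -> X},
        approximate_inverse_intertwining M N T S Psi F) :
  forall lam : R[i], is_eigenvalue S lam -> spectrum_B_omega M T lam.
Proof.
move=> lam [y y0 Sy] [U [_ Uc] [UK _]].
have [F [_ _ PsiF TF]] := hF.
have resolvent_F n : U (T (F n y) - F n (S y)) = F n y.
  by rewrite -[RHS]UK Sy linearZ.
have Fy0 : sigma_cvg M (fun n => F n y) 0.
  have := sigma_continuous_cvg Uc (TF y).
  by rewrite linear0; congr sigma_cvg; apply/funext => n; exact: resolvent_F.
have PsiFy0 := sigma_continuous_cvg hPsi.2 Fy0; rewrite linear0 in PsiFy0.
by move/eqP: y0; apply; exact: sigma_cvg_unique hN (PsiF y) PsiFy0.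
Qed.
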